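(* $BR_m(K_{2,2},K_{4,4})=14$ for each $m\in\{10,11,12,13\}$.
   Context: For bipartite graphs $H_1,H_2$ and a positive integer $m$, $BR_m(H_1,H_2)$ is the least positive integer $n$ such that for every subgraph $G$ of $K_{m,n}$ (parts of sizes $m$ and $n$), either $G$ contains a copy of $H_1$ or the bipartite complement $\overline{G}=K_{m,n}-E(G)$ contains a copy of $H_2$. *)

(* Defs.v *)
From mathcomp Require Import all_boot.

Set Implicit Arguments.
Unset Strict Implicit.
Unset Printing Implicit Defensive.

(* A graph on a vertex type T is given by its adjacency relation, a [rel T]. *)

Definition complete_bipartite (m n : nat) : rel ('I_m + 'I_n) :=
  fun x y => match x, y with
             | inl _, inr _ | inr _, inl _ => true
             | _, _ => false
             end.
Arguments complete_bipartite : clear implicits.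

Notation "''K_' ( m , n )" := (complete_bipartite m n)
  (at level 8, format "''K_' ( m ,  n )").

(* Subgraphs are taken to be spanning: the bipartite complement depends on the
   edges of G only, and adding the missing vertices as isolated ones does not
   affect which graphs without isolated vertices are contained in G. *)
Definition subgraph (T : Type) (G K : rel T) : Prop :=
  symmetric G /\ subrel G K.

(* The copy need not be induced.  When G is a subgraph of 'K_(m, n), the sides
   of a bipartite H may be sent to the two parts in either order. *)
Definition contains_copy (T S : Type) (G : rel T) (H : rel S) : Prop :=
  exists f : S -> T, injective f /\ forall x y, H x y -> G (f x) (f y).

Definition bipartite_complement (m n : nat) (G : rel ('I_m + 'I_n)) :
    rel ('I_m + 'I_n) :=
  fun x y => 'K_(m, n) x y && ~~ G x y.

Definition BR_property (S1 S2 : Type) (H1 : rel S1) (H2 : rel S2)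
    (m n : nat) : Prop :=
  forall G : rel ('I_m + 'I_n), subgraph G 'K_(m, n) ->
    contains_copy G H1 \/ contains_copy (bipartite_complement G) H2.

(* [is_BR H1 H2 m b] reads "BR_m(H1, H2) exists and equals b". *)
Definition is_BR (S1 S2 : Type) (H1 : rel S1) (H2 : rel S2)
    (m b : nat) : Prop :=
  [/\ 0 < b, BR_property H1 H2 m b
    & forall n, 0 < n -> BR_property H1 H2 m n -> b <= n].

(* Main.v *)
Require Import Defs.
From mathcomp Require Import all_boot perm matrix.
From mathcomp Require Import zify.

(** Lower bound: the incidence graph of the projective plane of order 3 has
    13 + 13 vertices and no K_{2,2}; any four of its lines cover at least
    4 + 3 + 2 + 1 = 10 of the 13 points, so no four points miss all of them.

    Upper bound: it suffices to show that a 10 x 14 Boolean matrix whose rows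
    pairwise share at most one column has four rows covering at most 10
    columns.  A counterexample may be chosen maximal for a lexicographic
    weight; then its rows have ascending degrees, rows of equal degree are
    lexicographically descending, and so are the columns.  Double counting
    bounds the number of ones by 43, which keeps the first rows sparse.  A
    search adding one row at a time shows that no matrix meets all these
    constraints. *)

Set Implicit Arguments.
Unset Strict Implicit.
Unset Printing Implicit Defensive.

(** * Positional numerals and lexicographic order *)

Lemma lex_sum_bound B N (f : 'I_N -> nat) :
  (forall k, f k < B) -> \sum_k f k * B ^ rev_ord k < B ^ N.
Proof.
elim: N f => [|N IHN] f ltfB; first by rewrite big_ord0.
rewrite big_ord_recl /= subSS subn0.
have /= := IHN (fun k => f (lift ord0 k)) (fun k => ltfB _).
under eq_bigr => i _ do rewrite -(subSS i.+1 N).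
move=> lt_rest; have := ltfB ord0.
rewrite -(leq_pmul2r (m := B ^ N)); last by case: (B ^ N) lt_rest.
by rewrite expnS mulSn; lia.
Qed.

(** Index [0] is the most significant digit. At the first difference [g] gains at least one unit of
    that place, which exceeds all that the later digits of [f] can contribute. *)
Lemma lex_sum_lt B N (f g : 'I_N -> nat) (i : 'I_N) :
    (forall k, f k < B) -> (forall k : 'I_N, k < i -> f k = g k) -> f i < g i ->
  \sum_k f k * B ^ rev_ord k < \sum_k g k * B ^ rev_ord k.
Proof.
elim: N f g i => [|N IHN] f g i ltfB eqfg ltfg; first by case: i {eqfg ltfg}.
rewrite !big_ord_recl /= subSS subn0.
under eq_bigr => k _ do rewrite (subSS k.+1 N).
under [X in _ < _ + X]eq_bigr => k _ do rewrite (subSS k.+1 N).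
case: (unliftP ord0 i) => [i'|] def_i; rewrite {}def_i in eqfg ltfg.
  rewrite (eqfg ord0) // ltn_add2l.
  by apply: (IHN (fun k => f (lift ord0 k)) _ i') => // k lt_ki; apply: eqfg.
have /= lt_rest :=
  lex_sum_bound (f := fun k => f (lift ord0 k)) (fun k => ltfB _).
move: ltfg; rewrite -(leq_pmul2r (m := B ^ N)); last by case: (B ^ N) lt_rest.
by rewrite mulSn; lia.
Qed.

(** * Sorted forms of Boolean matrices under row and column swaps *)

Section Canonical.
Variables m n : nat.
Implicit Types (M : 'M[bool]_(m, n)) (i : 'I_m) (j : 'I_n).

Definition degree M i := \sum_j M i j.

Definition row_code M i := \sum_j M i j * 2 ^ rev_ord j.

(* Rows of small degree get large keys; ties are broken by the row read as a
   binary number. *)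
Definition row_key M i := (n - degree M i) * 2 ^ n + row_code M i.

(** The row keys are the digits of a numeral, first row leading, in a base above every key; so
    weights compare as key sequences do lexicographically. *)
Definition weight M := \sum_i row_key M i * (n.+1 * 2 ^ n) ^ rev_ord i.

Lemma degree_le M i : degree M i <= n.
Proof.
rewrite -[leqRHS]card_ord -sum1_card; apply: leq_sum => j _; exact: leq_b1.
Qed.

Lemma row_code_lt M i : row_code M i < 2 ^ n.
Proof. by apply: lex_sum_bound => j; case: (M i j). Qed.

Lemma row_key_lt M i : row_key M i < n.+1 * 2 ^ n.
Proof.
have := row_code_lt M i; rewrite /row_key mulSn => lt_code.
have : (n - degree M i) * 2 ^ n <= n * 2 ^ n by rewrite leq_mul2r leq_subr orbT.
lia.
Qed.

(** Codes stay below [2 ^ n], so keys compare like the pairs of [n - degree] and code. *)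
Lemma row_key_le M i1 i2 :
  row_key M i2 <= row_key M i1 ->
  degree M i1 <= degree M i2 /\
  (degree M i1 = degree M i2 -> row_code M i2 <= row_code M i1).
Proof.
rewrite /row_key => le_key; split=> [|eq_deg]; last first.
  by rewrite eq_deg leq_add2l in le_key.
rewrite leqNgt; apply/negP => lt_deg.
have := degree_le M i1; have := degree_le M i2; have := row_code_lt M i1.
move: le_key.
set d1 := degree M i1 in lt_deg *; set d2 := degree M i2 in lt_deg *.
move=> le_key lt1 le2 le1.
have : (n - d1).+1 * 2 ^ n <= (n - d2) * 2 ^ n by rewrite leq_mul2r; lia.
by rewrite mulSn; lia.
Qed.

Definition rows_sorted M :=
  forall i1 i2, i1 < i2 -> row_key M i2 <= row_key M i1.

Definition cols_sorted M := forall i j1 j2, j1 < j2 ->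
  (forall k : 'I_m, k < i -> M k j1 = M k j2) -> M i j2 -> M i j1.

(** Take a matrix of maximal weight satisfying [P]: swapping two rows or two columns that are out of
    order would raise the weight. *)
Lemma exists_sorted (P : pred 'M[bool]_(m, n)) (M0 : 'M[bool]_(m, n)) :
    (forall M i1 i2, P M -> P (xrow i1 i2 M)) ->
    (forall M j1 j2, P M -> P (xcol j1 j2 M)) ->
  P M0 -> exists M, [/\ P M, rows_sorted M & cols_sorted M].
Proof.
move=> Prow Pcol PM0; case: (arg_maxnP weight PM0) => M PM maxM.
exists M; split=> // [i1 i2 lt12 | i j1 j2 lt12 eq_above Mj2].
- rewrite leqNgt; apply/negP => lt_key.
  have /negP[] : ~~ (weight M < weight (xrow i1 i2 M)).
    by rewrite -leqNgt; apply/maxM/Prow.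
  have keyE k : row_key (xrow i1 i2 M) k = row_key M (tperm i1 i2 k).
    rewrite /row_key /degree /row_code.
    by congr ((_ - _) * _ + _); apply: eq_bigr => j _; rewrite mxE.
  apply: (@lex_sum_lt _ _ _ _ i1) => [k|k lt_k|]; first exact: row_key_lt.
    by rewrite keyE tpermD // neq_ltn ?lt_k ?(ltn_trans lt_k) ?orbT.
  by rewrite keyE tpermL.
apply: contraT => Mj1.
have /negP[] : ~~ (weight M < weight (xcol j1 j2 M)).
  by rewrite -leqNgt; apply/maxM/Pcol.
have degE k : degree (xcol j1 j2 M) k = degree M k.
  rewrite /degree [RHS](reindex_inj (@perm_inj _ (tperm j1 j2))).
  by apply: eq_bigr => j _; rewrite mxE.
(* The column swap leaves the rows above [i] and all degrees unchanged, so row [i], whose code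
   grows, decides. *)
apply: (@lex_sum_lt _ _ _ _ i) => [k|k lt_k|]; first exact: row_key_lt.
  rewrite /row_key degE; congr (_ + _); apply: eq_bigr => j _; rewrite mxE.
  by case: tpermP => [->|->|//]; rewrite eq_above.
rewrite /row_key degE ltn_add2l.
apply: (@lex_sum_lt _ _ _ _ j1) => [j|j lt_j|]; first by case: (M i j).
  by rewrite mxE tpermD // neq_ltn ?lt_j ?(ltn_trans lt_j) ?orbT.
by rewrite mxE tpermL Mj2 (negbTE Mj1).
Qed.

Lemma rows_sorted_lex M i1 i2 j : rows_sorted M -> i1 < i2 ->
    degree M i1 = degree M i2 ->
    (forall k : 'I_n, k < j -> M i1 k = M i2 k) -> M i2 j -> M i1 j.
Proof.
move=> sortM lt12 eq_deg eq_left Mj.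
have [_ /(_ eq_deg)] := row_key_le (sortM _ _ lt12).
apply: contraLR => Mi1; rewrite -ltnNge.
apply: (@lex_sum_lt _ _ _ _ j) => [k|k lt_k|]; first by case: (M i1 k).
  by rewrite eq_left.
by rewrite Mj (negbTE Mi1).
Qed.

End Canonical.

(** * The search over bit vectors *)

(** The recursive call sits under an [if] because call-by-value evaluation would compute both
    arguments of a connective. *)
Fixpoint disjoint_bits (a b : bitseq) : bool :=
  match a, b with
  | x :: a', y :: b' => if x && y then false else disjoint_bits a' b'
  | _, _ => true
  end.

Fixpoint or_bits (a b : bitseq) : bitseq :=
  match a, b with
  | x :: a', y :: b' => (x || y) :: or_bits a' b'
  | _, _ => [::]
  end.

(* The flag tells whether a column agrees with the previous one on all the rows
   placed so far, in which case these two columns are still interchangeable. *)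
Fixpoint mark (prev : option bitseq) (cols : seq bitseq) :
    seq (bool * bitseq) :=
  if cols is h :: cols' then (prev == Some h, h) :: mark (Some h) cols'
  else [::].

(* All rows that can extend a partial matrix, given by its columns (topmost
   entry last): [prev] is the bit just chosen, [tight] says that the new row
   agrees so far with the last row and must not exceed it, and [hit] marks the
   earlier rows which the new row already meets. *)
Fixpoint next_rows (cols : seq (bool * bitseq)) (ones zeros : nat)
    (prev tight : bool) (hit : bitseq) : seq bitseq :=
  if cols is (same, h) :: cols' then
    (if ones is ones'.+1 then
       if (if same then prev else true) then
       if (if tight then head false h else true) then
       if disjoint_bits h hit then
         map (cons true)
           (next_rows cols' ones' zeros true tight (or_bits h hit))
       else [::] else [::] else [::] else [::])
    ++
    (if zeros is zeros'.+1 then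
       map (cons false)
         (next_rows cols' ones zeros' false
            (if tight then ~~ head false h else false) hit)
     else [::])
  else [:: [::]].

Fixpoint columns (n : nat) (rows : seq bitseq) : seq bitseq :=
  if rows is r :: rows' then [seq x.1 :: x.2 | x <- zip r (columns n rows')]
  else nseq n [::].

Fixpoint unions (n t : nat) (rows : seq bitseq) : seq bitseq :=
  match t, rows with
  | 0, _ => [:: nseq n false]
  | _, [::] => [::]
  | t'.+1, r :: rows' => map (or_bits r) (unions n t' rows') ++ unions n t rows'
  end.

(* [rows] lists the rows placed so far, the last one first; [last] is its degree
   and [sum] the total degree.  The result [true] means that the partial matrix
   cannot be completed by [k] more rows. *)
Fixpoint search (k : nat) (rows : seq bitseq) (last sum : nat) : bool :=
  if k is k'.+1 then
    let cols := mark None (columns 14 rows) in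
    let us := [seq u <- unions 14 3 rows | count id u < 11] in
    all (fun d =>
      if sum + d * k <= 43 then
        all (fun r =>
          if all (fun u => 11 <= count id (or_bits u r)) us then
            search k' (r :: rows) d (sum + d)
          else true)
          (next_rows cols d (14 - d) true (d == last)
             (nseq (size rows) false))
      else true)
      (iota last (15 - last))
  else false.

(** A completed matrix yields [false], so [true] at the root says that no branch reaches ten
    rows. *)
Lemma search_complete : search 10 [::] 0 0.
Proof. by vm_compute. Qed.

(** * Completeness of the row generator *)

Lemma disjoint_bits_or a b c : size a = size b ->
  disjoint_bits c (or_bits a b) = disjoint_bits c a && disjoint_bits c b.
Proof.
elim: a b c => [|x a IHa] [|y b] [|z c] //= [eq_ab].
by rewrite IHa //; case: x y z => [] [] [] //=; rewrite ?andbT ?andbF.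
Qed.

Lemma size_or_bits a b : size a = size b -> size (or_bits a b) = size b.
Proof. by elim: a b => [|x a IHa] [|y b] //= [/IHa->]. Qed.

Lemma or_bits_map (T : Type) (f g : T -> bool) (s : seq T) :
  or_bits (map f s) (map g s) = [seq f x || g x | x <- s].
Proof. by elim: s => //= x s ->. Qed.

Lemma disjoint_bits_map (T : Type) (f g : T -> bool) (s : seq T) :
  disjoint_bits (map f s) (map g s) = ~~ has (fun x => f x && g x) s.
Proof. by elim: s => //= x s ->; case: (f x && g x). Qed.

Lemma disjoint_bits_nseq a n : disjoint_bits a (nseq n false).
Proof. by elim: n a => [|n IHn] [|x a] //=; rewrite andbF. Qed.

(** Generalised for induction on the columns [s] still to be filled: [h x] holds the earlier entries
    of column [x], [r] is the new row, and [p] is the column just treated. The hypotheses on order,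
    [tight], [hit] and pairs of columns say that no pruning test rejects [r]. *)
Lemma mem_next_rows (T : eqType) (h : T -> bitseq) (r : T -> bool)
    (s : seq T) (p : option T) (ones zeros : nat) (tight : bool)
    (hit : bitseq) :
    count r s = ones -> size s = ones + zeros ->
    (forall x, x \in s -> size (h x) = size hit) ->
    (let e x y := (h x == h y) ==> r y ==> r x in
     if p is Some x then path e x s else sorted e s) ->
    (tight -> forall s1 x s2, s = s1 ++ x :: s2 ->
      {in s1, forall y, r y = head false (h y)} -> r x -> head false (h x)) ->
    {in s, forall x, r x -> disjoint_bits (h x) hit} ->
    pairwise (fun x y => r x ==> r y ==> disjoint_bits (h y) (h x)) s ->
  map r s \in next_rows (mark (omap h p) (map h s)) ones zeros
                (oapp r true p) tight hit.
Proof.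
elim: s p ones zeros tight hit => [|x s IHs] p ones zeros tight hit //=.
move=> def_ones def_zeros size_h class_ok tight_ok hit_ok.
case/andP=> /allP pair_x pair_s.
have path_s : path (fun x y => (h x == h y) ==> r y ==> r x) x s.
  by case: p class_ok => [y|] //= /andP[].
have size_s y : y \in s -> size (h y) = size hit.
  by move=> sy; apply: size_h; rewrite inE sy orbT.
have size_x : size (h x) = size hit by apply: size_h; rewrite mem_head.
rewrite mem_cat; case rx: (r x) def_ones => /=.
- case: ones def_zeros => // ones [def_zeros] [def_ones]; apply/orP; left.
  have -> : (if omap h p == Some (h x) then oapp r true p else true).
    case: p class_ok => [y|] //= /andP[e_yx _].
    case: ifP => // /eqP[eq_h]; rewrite eq_h eqxx rx in e_yx.
    by move: e_yx.
  have -> : (if tight then head false (h x) else true).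
    by case: tight tight_ok => // /(_ isT [::] x s erefl) ->.
  rewrite hit_ok ?mem_head //.
  apply: map_f.
  have /= := IHs (Some x) ones zeros tight (or_bits (h x) hit).
  rewrite rx; apply=> //.
  + by move=> y sy; rewrite size_or_bits // size_s.
  + move=> t s1 y s2 def_s eq_s1; apply: (tight_ok t (x :: s1) y s2).
      by rewrite def_s.
    move=> z; rewrite inE => /predU1P[-> | /eq_s1 //].
    by rewrite rx (tight_ok t [::] x s).
  + move=> y sy ry; rewrite disjoint_bits_or //.
    rewrite hit_ok ?inE ?sy ?orbT // andbT.
    by have := pair_x _ sy; rewrite rx ry.
- rewrite add0n => def_ones.
  (* Without a zero left, [ones] would be the size of [x :: s], one more than [s] allows. *)
  have le_ones : ones <= size s by rewrite -def_ones count_size.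
  case: zeros def_zeros => [|zeros] def_zeros; first by lia.
  apply/orP; right; apply: map_f.
  have /= := IHs (Some x) ones zeros
    (if tight then ~~ head false (h x) else false) hit.
  rewrite rx; apply=> //.
  + by lia.
  + case: tight tight_ok => // tight_ok /negbTE not_h s1 y s2 def_s eq_s1.
    apply: (tight_ok isT (x :: s1) y s2); first by rewrite def_s.
    by move=> z; rewrite inE => /predU1P[-> | /eq_s1 //]; rewrite rx not_h.
  + by move=> y sy; apply: hit_ok; rewrite inE sy orbT.
Qed.

(** * Matrices of counterexamples and double counting *)

Section Avoiding.
Variables m n : nat.
Implicit Types (M : 'M[bool]_(m, n)) (i k : 'I_m) (j : 'I_n).

Definition common M i k := [set j | M i j && M k j].

Definition covered M (S : {set 'I_m}) := [set j | [exists i in S, M i j]].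

(** Any two rows share at most one column, so the ones hold no $K_{2,2}$; any four rows miss at most
    three columns, so the zeros hold no $K_{4,4}$. *)
Definition avoiding M :=
  [forall i, forall k, (i != k) ==> (#|common M i k| <= 1)] &&
  [forall S : {set 'I_m}, (#|S| == 4) ==> (n <= #|covered M S| + 3)].

Lemma avoidingP M : reflect
  ((forall i k, i != k -> #|common M i k| <= 1) /\
   (forall S : {set 'I_m}, #|S| = 4 -> n <= #|covered M S| + 3))
  (avoiding M).
Proof.
apply: (iffP andP) => -[com cov]; split.
- by move=> i k ik; have /forallP/(_ k)/implyP/(_ ik) := forallP com i.
- by move=> S /eqP S4; apply: (implyP (forallP cov S)).
- by apply/forallP => i; apply/forallP => k; apply/implyP => /com.
- by apply/forallP => S; apply/implyP => /eqP /cov.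
Qed.

Lemma avoiding_xrow M i1 i2 : avoiding M -> avoiding (xrow i1 i2 M).
Proof.
move/avoidingP=> [com cov]; apply/avoidingP; split=> [i k ik | S S4].
  have := com (tperm i1 i2 i) (tperm i1 i2 k).
  rewrite (inj_eq perm_inj) => /(_ ik); congr (_ <= _).
  by apply: eq_card => j; rewrite !inE !mxE.
have := cov (tperm i1 i2 @: S); rewrite card_imset ?S4; last exact: perm_inj.
move=> /(_ erefl); congr (_ <= _ + _); apply: eq_card => j; rewrite !inE.
apply/existsP/existsP => [[_ /andP[/imsetP[i Si ->] Mij]]|[i /andP[Si Mij]]].
  by exists i; rewrite Si mxE.
by exists (tperm i1 i2 i); rewrite imset_f //; rewrite mxE in Mij.
Qed.

Lemma avoiding_xcol M j1 j2 : avoiding M -> avoiding (xcol j1 j2 M).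
Proof.
have card_tperm (A : {set 'I_n}) : #|[set j | tperm j1 j2 j \in A]| = #|A|.
  rewrite -(card_preimset A (@perm_inj _ (tperm j1 j2))).
  by apply: eq_card => j; rewrite !inE.
move/avoidingP=> [com cov]; apply/avoidingP; split=> [i k ik | S S4].
  have := com i k ik; rewrite -card_tperm; congr (_ <= _).
  by apply: eq_card => j; rewrite !inE !mxE.
have := cov S S4; rewrite -card_tperm; congr (_ <= _ + _).
apply: eq_card => j; rewrite !inE; apply: eq_existsb => i.
by rewrite mxE.
Qed.

Definition row_bits M i : bitseq := [seq M i j | j <- enum 'I_n].

Lemma count_row_bits M i : count (M i) (enum 'I_n) = degree M i.
Proof.
rewrite -sum1_count big_mkcond big_enum /=.
by apply: eq_bigr => j _; case: (M i j).
Qed.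

(* With [e j] the degree of column [j], this follows from
   [5 * e j <= e j ^ 2 + 6] and a count of the pairs of rows meeting in [j]. *)
Lemma sum_degree_bound M : avoiding M ->
  4 * \sum_i degree M i <= m * m.-1 + 6 * n.
Proof.
move/avoidingP=> [com _]; pose e j := \sum_i M i j.
have sum_e : \sum_i degree M i = \sum_j e j by rewrite exchange_big.
(* The squares count triples of two rows and a common column: equal rows contribute the degrees, and
   each of the [m * m.-1] ordered pairs of distinct rows at most one. *)
have sum_e2 : \sum_j e j * e j <= \sum_i degree M i + m * m.-1.
  have -> : \sum_j e j * e j = \sum_i \sum_k #|common M i k|.
    under eq_bigr => j _ do rewrite big_distrlr.
    rewrite exchange_big; apply: eq_bigr => i _.
    rewrite exchange_big; apply: eq_bigr => k _ /=.
    rewrite -sum1dep_card [RHS]big_mkcond; apply: eq_bigr => j _.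
    by case: (M i j) (M k j) => [] [].
  have -> : m * m.-1 = \sum_(i < m) m.-1 by rewrite sum_nat_const card_ord.
  rewrite -big_split; apply: leq_sum => i _; rewrite (bigD1 i) //=.
  apply: leq_add.
    rewrite -sum1dep_card big_mkcond; apply: leq_sum => j _.
    by case: (M i j).
  rewrite -[m in m.-1]card_ord (cardD1 i) inE /= -sum1_card.
  rewrite [leqRHS](eq_bigl (fun k => k != i)) => [|k]; last first.
    by rewrite !inE andbT.
  by apply: leq_sum => k ki; rewrite com // eq_sym.
(* This is $(e-2)(e-3) \ge 0$, valid for every integer $e$. *)
have : 5 * \sum_j e j <= \sum_j e j * e j + \sum_(j < n) 6.
  rewrite -big_split big_distrr; apply: leq_sum => j _ /=.
  by case: (e j) => [|[|[|x]]] //; nia.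
by rewrite sum_nat_const card_ord -sum_e; lia.
Qed.

End Avoiding.

(** * Soundness of the search *)

Lemma pairwise_enum_ord n : pairwise (fun x y : 'I_n => x < y) (enum 'I_n).
Proof.
have := iota_ltn_sorted 0 n.
by rewrite (sorted_pairwise ltn_trans) -val_enum_ord pairwise_map.
Qed.

Lemma enum_ord_cat n (s1 s2 : seq 'I_n) (i : 'I_n) :
    enum 'I_n = s1 ++ i :: s2 ->
  s1 =i [pred k : 'I_n | k < i] /\ s2 =i [pred k : 'I_n | i < k].
Proof.
move=> def_enum; have := pairwise_enum_ord n; rewrite def_enum pairwise_cat /=.
case/and3P=> /allrelP lt12 _ /andP[/allP lt2 _].
have lt1 k : k \in s1 -> k < i by move=> s1k; rewrite lt12 ?mem_head.
have mem_k (k : 'I_n) : [|| k \in s1, k == i | k \in s2].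
  by have := mem_enum 'I_n k; rewrite def_enum mem_cat inE.
split=> k; rewrite inE; apply/idP/idP => [|lt_k].
- exact: lt1.
- case/or3P: (mem_k k) => // [/eqP eq_k|/lt2]; last by lia.
  by rewrite eq_k ltnn in lt_k.
- exact: lt2.
- case/or3P: (mem_k k) => // [/lt1|/eqP eq_k]; first by lia.
  by rewrite eq_k ltnn in lt_k.
Qed.

Lemma columns_row_bits m n (M : 'M[bool]_(m, n)) (s : seq 'I_m) :
  columns n (map (row_bits M) s) = [seq [seq M i j | i <- s] | j <- enum 'I_n].
Proof.
elim: s => [|i s IHs] /=.
  by rewrite -[n in nseq n _]size_enum_ord; elim: (enum _) => //= j t <-.
by rewrite IHs zip_map -map_comp.
Qed.

Lemma unions_row_bits m n (M : 'M[bool]_(m, n)) t (s : seq 'I_m) u :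
    uniq s -> u \in unions n t (map (row_bits M) s) ->
  exists S : seq 'I_m, [/\ uniq S, size S = t, {subset S <= s}
    & u = [seq has (M^~ j) S | j <- enum 'I_n]].
Proof.
elim: s t u => [|i s IHs] [|t] u //=.
- rewrite inE => _ /eqP->; exists [::]; split=> //.
  by rewrite -[n in nseq n _]size_enum_ord; elim: (enum _) => //= j r ->.
- rewrite inE => _ /eqP->; exists [::]; split=> //.
  by rewrite -[n in nseq n _]size_enum_ord; elim: (enum _) => //= j r ->.
case/andP=> s'i uniq_s; rewrite mem_cat => /orP[/mapP[v] | ].
  case/(IHs _ _ uniq_s) => S [uniq_S size_S sub_S ->] ->.
  exists (i :: S); split=> /=; rewrite ?size_S ?uniq_S ?andbT //.
  - by apply: contra s'i; apply: sub_S.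
  - by move=> k; rewrite !inE => /predU1P[-> | /sub_S->]; rewrite ?eqxx ?orbT.
  - by rewrite or_bits_map.
case/(IHs t.+1 _ uniq_s) => S [uniq_S size_S sub_S ->].
by exists S; split=> // k /sub_S sk; rewrite inE sk orbT.
Qed.

(** The rows of [M] themselves trace a branch that no test prunes, and it ends in [false]. Here [s1]
    holds the rows already placed and [s2] the [k] remaining ones. *)
Lemma search_sound (M : 'M[bool]_(10, 14)) (k : nat) (s1 s2 : seq 'I_10) :
    avoiding M -> rows_sorted M -> cols_sorted M ->
    enum 'I_10 = s1 ++ s2 -> size s2 = k ->
  search k (map (row_bits M) (rev s1)) (last 0 (map (degree M) s1))
    (sumn (map (degree M) s1)) = false.
Proof.
move=> avoidM sort_r sort_c.
have /avoidingP[com cov] := avoidM.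
elim: k s1 s2 => [//|k IHk] s1 [//|i s2] def_enum [size_s2].
have [mem1 mem2] := enum_ord_cat def_enum.
have uniq_s1 : uniq s1.
  by have := enum_uniq 'I_10; rewrite def_enum cat_uniq => /and3P[].
have deg_ge (j : 'I_10) : i <= j -> degree M i <= degree M j.
  rewrite leq_eqVlt => /predU1P[/val_inj-> // | /sort_r /row_key_le[]//].
have last_le : last 0 (map (degree M) s1) <= degree M i.
  case/lastP: s1 {def_enum uniq_s1 IHk} mem1 => // s1 i' mem1.
  rewrite map_rcons last_rcons.
  have : i' \in rcons s1 i' by rewrite mem_rcons mem_head.
  by rewrite mem1 inE => /sort_r /row_key_le[].
(* The double count gives 4 times the total at most 90 + 84 = 174, hence a total of at most 43; each
   of the [k.+1] remaining rows has at least the degree of row [i]. *)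
have sum_le : sumn (map (degree M) s1) + degree M i * k.+1 <= 43.
  have := sum_degree_bound avoidM.
  rewrite -big_enum def_enum big_cat big_cons /=.
  have : degree M i * k <= \sum_(j <- s2) degree M j.
    have -> : degree M i * k = \sum_(j <- s2) degree M i.
      by rewrite big_const_seq count_predT iter_addn_0 size_s2.
    by rewrite !big_seq; apply: leq_sum => j; rewrite mem2 => /ltnW/deg_ge.
  rewrite sumnE big_map; lia.
have deg_le := degree_le M i.
apply/negP => /= /allP /(_ (degree M i)).
rewrite mem_iota last_le /= subnKC; last first.
  by rewrite (leq_trans last_le) ?(leq_trans deg_le).
rewrite ltnS deg_le sum_le => /(_ isT) /allP /(_ (row_bits M i)).
have -> : row_bits M i \in next_rows
      (mark None (columns 14 (map (row_bits M) (rev s1)))) (degree M i)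
      (14 - degree M i) true (degree M i == last 0 (map (degree M) s1))
      (nseq (size (map (row_bits M) (rev s1))) false).
  rewrite columns_row_bits size_map.
  apply: (@mem_next_rows _ (fun j => [seq M k0 j | k0 <- rev s1]) (M i) _ None).
  - exact: count_row_bits.
  - by rewrite size_enum_ord subnKC.
  - by move=> j _; rewrite size_map size_nseq.
  - apply/pairwise_sorted/(sub_pairwise _ (pairwise_enum_ord 14)) => j1 j2 lt_j.
    apply/implyP => /eqP/eq_in_map eq_j; apply/implyP.
    by apply: sort_c lt_j _ => i' lt_i'; apply: eq_j; rewrite mem_rev mem1.
  - move=> /eqP eq_last t1 j t2 def_cols eq_t1 Mij.
    have [mem_t1 _] := enum_ord_cat def_cols.
    (* For the first row, [last] takes its default [0]; a row of degree 0 cannot contain the one at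
       [j]. *)
    case/lastP: s1 eq_last eq_t1 {def_enum IHk uniq_s1 last_le sum_le} mem1.
      by rewrite /degree (bigD1 j) //= Mij.
    move=> s1 i'; rewrite map_rcons last_rcons rev_rcons /=.
    move=> eq_last eq_t1 mem1.
    apply: rows_sorted_lex Mij => // [|j' lt_j'].
      by have := mem_head i' s1; rewrite -mem_rcons mem1.
    by rewrite eq_t1 ?mem_t1.
  - by move=> j _ _; rewrite disjoint_bits_nseq.
  - apply: sub_pairwise (pairwise_enum_ord 14) => j1 j2 lt_j.
    apply/implyP => M1; apply/implyP => M2.
    rewrite disjoint_bits_map; apply/hasPn => i'.
    rewrite mem_rev mem1 inE => lt_i'.
    apply/negP => /andP[Mi'2 Mi'1].
    have : #|common M i' i| <= 1 by rewrite com // neq_ltn lt_i'.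
    rewrite leqNgt => /negP; apply; apply/card_gt1P; exists j1, j2.
    by rewrite !inE M1 M2 Mi'1 Mi'2 neq_ltn lt_j.
move=> /(_ isT); rewrite ifT => [|].
  have := IHk (rcons s1 i) s2.
  rewrite cat_rcons rev_rcons map_rcons last_rcons sumn_rcons => -> //.
apply/allP => u; rewrite mem_filter => /andP[_].
case/unions_row_bits; first by rewrite rev_uniq.
move=> S [uniq_S size_S sub_S ->].
have S'i : i \notin S.
  by apply/negP => /sub_S; rewrite mem_rev mem1 inE ltnn.
(* Adding 3 turns the threshold 11 into the 14 of [cov], used for row [i] with three earlier
   rows. *)
rewrite or_bits_map count_map -(leq_add2r 3).
have := cov [set i' in i :: S].
rewrite cardsE (card_uniqP _) /= ?S'i // size_S => /(_ erefl).
congr (_ <= _ + _).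
rewrite -sum1dep_card -sum1_count [LHS]big_mkcond [RHS]big_mkcond big_enum.
apply: eq_bigr => j _ /=; congr (if _ then _ else _).
apply/existsP/orP => [[i' /andP[]] | [/hasP[i' Si'] | ] Mj].
- rewrite !inE => /predU1P[-> | Si'] Mj; [by right | left].
  by apply/hasP; exists i'.
- by exists i'; rewrite !inE Si' orbT.
- by exists i; rewrite !inE eqxx.
Qed.

(** On a sorted counterexample the search from the empty matrix would return both [true] and
    [false]. *)
Lemma not_avoiding (M : 'M[bool]_(10, 14)) : ~~ avoiding M.
Proof.
apply/negP => /(exists_sorted (@avoiding_xrow _ _) (@avoiding_xcol _ _)).
case=> M' [avoidM' sort_r sort_c].
have := @search_sound M' 10 [::] (enum 'I_10) avoidM' sort_r sort_c erefl.
by rewrite size_enum_ord search_complete => /(_ erefl).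
Qed.

(** * Copies as pairs of vertex sets, and the upper bound *)

Lemma sets_contain_copy m n s t (G : rel ('I_m + 'I_n))
    (A : {set 'I_m}) (B : {set 'I_n}) :
    symmetric G -> s <= #|A| -> t <= #|B| ->
    {in A & B, forall i j, G (inl i) (inr j)} ->
  contains_copy G 'K_(s, t).
Proof.
move=> symG leA leB AB.
exists (fun x => match x with
  | inl a => inl (enum_val (widen_ord leA a))
  | inr b => inr (enum_val (widen_ord leB b))
  end); split.
  by move=> [a|b] [a'|b'] // [] /enum_val_inj/(congr1 val)/= /val_inj->.
by move=> [a|b] [a'|b'] //= _; last rewrite symG; rewrite AB ?enum_valP.
Qed.

(** Edges join opposite parts, so the image of one vertex settles the side of all the others; as
    both sides of the copy have size [s], they can be exchanged if that vertex lands in the wrong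
    part. *)
Lemma copy_contain_sets m n s (G : rel ('I_m + 'I_n)) :
    subgraph G 'K_(m, n) -> 0 < s -> contains_copy G 'K_(s, s) ->
  exists (f : 'I_s -> 'I_m) (g : 'I_s -> 'I_n),
    [/\ injective f, injective g & forall a b, G (inl (f a)) (inr (g b))].
Proof.
case=> symG subG s_gt0 [h [inj_h adj_h]]; pose a0 := Ordinal s_gt0.
wlog [i0 def_i0] : h inj_h adj_h / exists i0, h (inl a0) = inl i0.
  move=> wlog_h; case def_a0: (h (inl a0)) => [i0|j0].
    by apply: (wlog_h h) => //; exists i0.
  pose sw (x : 'I_s + 'I_s) : 'I_s + 'I_s :=
    match x with inl a => inr a | inr b => inl b end.
  have swK : involutive sw by case.
  apply: (wlog_h (h \o sw)); first exact: inj_comp inj_h (inv_inj swK).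
    by move=> x y xy; apply: adj_h; case: x y xy => [a|b] [a'|b'].
  have /adj_h/subG : 'K_(s, s) (inl a0) (inr a0) by [].
  by rewrite def_a0 /=; case: (h (inr a0)) => // i _; exists i.
have [g def_g] : exists g, forall b, h (inr b) = inr (g b).
  apply: (fin_all_exists (P := fun b j => h (inr b) = inr j)) => b.
  have /adj_h/subG : 'K_(s, s) (inl a0) (inr b) by [].
  by rewrite def_i0; case: (h (inr b)) => // j _; exists j.
have [f def_f] : exists f, forall a, h (inl a) = inl (f a).
  apply: (fin_all_exists (P := fun a i => h (inl a) = inl i)) => a.
  have /adj_h/subG : 'K_(s, s) (inl a) (inr a0) by [].
  by rewrite def_g; case: (h (inl a)) => // i _; exists i.
exists f, g; split=> [a a' eq_a | b b' eq_b | a b].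
- have [] // : inl a = inl a' :> 'I_s + 'I_s.
  by apply: inj_h; rewrite !def_f eq_a.
- have [] // : inr b = inr b' :> 'I_s + 'I_s.
  by apply: inj_h; rewrite !def_g eq_b.
- by rewrite -def_f -def_g adj_h.
Qed.

Lemma complement_subgraph m n (G : rel ('I_m + 'I_n)) :
  symmetric G -> subgraph (bipartite_complement G) 'K_(m, n).
Proof.
move=> symG; split=> [x y|x y /andP[] //].
by rewrite /bipartite_complement symG; case: x y => [i|j] [i'|j'].
Qed.

(** The first ten vertices of the [m]-part suffice: their matrix is not avoiding, and each way of
    failing gives one of the two copies. *)
Lemma BR_property_14 m : 10 <= m -> BR_property 'K_(2, 2) 'K_(4, 4) m 14.
Proof.
move=> le_m G [symG subG]; pose w := widen_ord le_m.
have inj_w : injective w by move=> i i' /(congr1 val)/= /val_inj.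
pose M : 'M[bool]_(10, 14) := (\matrix_(i, j) G (inl (w i)) (inr j))%R.
have := not_avoiding M.
rewrite negb_and => /orP[/forallPn[i /forallPn[k]] | /forallPn[S]].
  rewrite negb_imply -ltnNge => /andP[ik com]; left.
  apply: (@sets_contain_copy _ _ _ _ _ [set w i; w k] (common M i k)) => //.
    by rewrite cards2 (inj_eq inj_w) ik.
  by move=> i' j; rewrite !inE !mxE => /orP[] /eqP-> /andP[].
rewrite negb_imply -ltnNge => /andP[/eqP S4 cov]; right.
apply: (@sets_contain_copy _ _ _ _ _ (w @: S) (~: covered M S)).
- by have [] := complement_subgraph symG.
- by rewrite card_imset ?S4.
(* At most 10 of the 14 columns are covered, which leaves four. *)
- have := cardsC (covered M S); rewrite card_ord => eq_cov.
  by rewrite -(leq_add2l #|covered M S|) eq_cov -(leq_add2r 3); lia.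
move=> _ j /imsetP[i Si ->]; rewrite !inE => /existsPn/(_ i).
by rewrite Si mxE.
Qed.

(** * Lower bound from the projective plane of order 3 *)

(* [{0, 1, 3, 9}] is a perfect difference set modulo 13. *)
Definition plane_incident (i j : nat) : bool :=
  (i + j) %% 13 \in [:: 0; 1; 3; 9].

Definition plane_graph m n : rel ('I_m + 'I_n) := fun x y =>
  match x, y with
  | inl i, inr j | inr j, inl i => plane_incident i j
  | _, _ => false
  end.

Lemma plane_subgraph m n : subgraph (@plane_graph m n) 'K_(m, n).
Proof. by split=> [] [i|j] [i'|j']. Qed.

Definition line (j : nat) := [set i : 'I_13 | plane_incident i j].

Lemma card_ord_set n (p : pred nat) :
  #|[set i : 'I_n | p i]| = count p (iota 0 n).
Proof.
rewrite -val_enum_ord count_map -sum1dep_card -sum1_count.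
by rewrite [LHS]big_mkcond [RHS]big_mkcond big_enum.
Qed.

Lemma card_line j : j < 13 -> #|line j| = 4.
Proof.
rewrite /line (card_ord_set 13 (plane_incident^~ j)) => lt_j.
apply/eqP; move: j lt_j.
have /allP lines : all (fun j => count (plane_incident^~ j) (iota 0 13) == 4)
                       (iota 0 13) by vm_compute.
by move=> j lt_j; apply: lines; rewrite mem_iota.
Qed.

(** A nonzero residue modulo 13 is the difference of exactly one ordered pair from [{0, 1, 3, 9}],
    so [j - k] determines the common point. Evaluation checks all pairs. *)
Lemma card_lineI j k : j < 13 -> k < 13 -> j != k ->
  #|line j :&: line k| <= 1.
Proof.
have /allP lines : all (fun j => all (fun k => (j != k) ==>
    (count (fun i => plane_incident i j && plane_incident i k) (iota 0 13)
       <= 1))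
  (iota 0 13)) (iota 0 13) by vm_compute.
move=> lt_j lt_k jk; have -> : line j :&: line k =
    [set i : 'I_13 | plane_incident i j && plane_incident i k].
  by apply/setP => i; rewrite !inE.
rewrite (card_ord_set _ (fun i => plane_incident i j && plane_incident i k)).
have := lines j; rewrite mem_iota => /(_ lt_j)/allP/(_ k).
by rewrite mem_iota => /(_ lt_k)/implyP; apply.
Qed.

(** Each new set meets every earlier one at most once, so in total at most 0 + 1 + 2 + ... points
    are lost, a binomial coefficient. *)
Lemma leq_card_bigcup (I : eqType) (T : finType) (L : I -> {set T})
    (s : seq I) (q : nat) :
    uniq s -> (forall b, #|L b| = q) ->
    (forall b c, b != c -> #|L b :&: L c| <= 1) ->
  size s * q <= #|\bigcup_(b <- s) L b| + 'C(size s, 2).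
Proof.
move=> uniq_s cardL cardLI; elim: s uniq_s => // b s IHs /= /andP[s'b /IHs].
have le_meet : #|L b :&: \bigcup_(c <- s) L c| <= size s.
  elim: s s'b {IHs} => [|c s IHs]; first by rewrite big_nil setI0 cards0.
  rewrite inE negb_or big_cons setIUr => /andP[bc /IHs le_s].
  by apply: leq_trans (leq_card_setU _ _).1 _; apply: leq_add (cardLI _ _ bc) _.
rewrite big_cons binS bin1 mulSn => le_s.
have := cardsUI (L b) (\bigcup_(c <- s) L c); rewrite cardL.
move: le_meet le_s.
set x := #|_ :&: _|; set y := #|\bigcup_(c <- s) L c|; set z := #|_ :|: _|.
by lia.
Qed.

Lemma plane_graph_bipartite_ramsey m n : m <= 13 -> n <= 13 ->
  ~ BR_property 'K_(2, 2) 'K_(4, 4) m n.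
Proof.
move=> le_m le_n /(_ _ (plane_subgraph m n)) [].
  case/(@copy_contain_sets _ _ 2 _ (plane_subgraph m n) isT) => f [g].
  case=> inj_f inj_g inc.
  pose w := widen_ord le_m.
  have {}inc a b : plane_incident (f a) (g b) := inc a b.
  have lt_g b : g b < 13 by apply: leq_trans le_n.
  (* A $K_{2,2}$ would give two distinct lines through two distinct points. *)
  have := card_lineI (lt_g ord0) (lt_g ord_max).
  rewrite (inj_eq val_inj) (inj_eq inj_g) => /(_ isT).
  rewrite leqNgt => /negP; apply; apply/card_gt1P.
  exists (w (f ord0)), (w (f ord_max)).
  rewrite !inE /= !inc; split=> //.
  by rewrite -(inj_eq val_inj) /= (inj_eq val_inj) (inj_eq inj_f).
have [symG _] := plane_subgraph m n.
case/(@copy_contain_sets _ _ 4 _ (complement_subgraph symG) isT) => f [g].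
case=> inj_f inj_g inc.
pose L b := line (g b); pose w := widen_ord le_m.
have cardL b : #|L b| = 4 by rewrite card_line // (leq_trans _ le_n).
have cardLI b c : b != c -> #|L b :&: L c| <= 1.
  move=> bc; apply: card_lineI; rewrite ?(leq_trans _ le_n) //.
  by rewrite (inj_eq val_inj) (inj_eq inj_g).
have card_f : #|[set w (f a) | a in 'I_4]| = 4.
  by rewrite card_imset ?card_ord // => a a' /(congr1 val)/= /val_inj/inj_f.
pose F := [set w (f a) | a in 'I_4].
have FL b : [disjoint F & L b].
  apply/pred0P => i /=; apply/andP => -[/imsetP[a _ ->]]; rewrite inE.
  by apply/negP; have /andP[] := inc a b.
pose U := \bigcup_(b <- enum 'I_4) L b.
(* Four lines cover at least 16 - 6 = 10 points, whereas the four points of [F] outside them leave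
   at most 9 of the 13. *)
have := leq_card_bigcup (enum_uniq 'I_4) cardL cardLI.
rewrite size_enum_ord -/U (_ : 'C(4, 2) = 6) // leqNgt => /negP; apply.
have FU : F \subset ~: U.
  rewrite subsetC /U big_enum; apply/bigcupsP => b _.
  by rewrite -disjoints_subset disjoint_sym.
have := subset_leq_card FU; rewrite card_f => le_F.
have := cardsC U; rewrite card_ord; move: le_F.
by set x := #|~: U|; set y := #|U|; lia.
Qed.

Theorem theorem8 (m : nat) (hm : m \in [:: 10; 11; 12; 13]) :
  is_BR 'K_(2, 2) 'K_(4, 4) m 14.
Proof.
have /andP[m_ge10 m_le13] : 10 <= m <= 13.
  by move: hm; rewrite !inE => /or4P[] /eqP->.
split=> // [|n _ BR_n]; first exact: BR_property_14.
by rewrite ltnNge; apply/negP => /(plane_graph_bipartite_ramsey m_le13); apply.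
Qed.
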